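(* For every graph $G$ with $\chi(G) \ge 3$, $\mathit{elb}(G) = \lceil \log_2\log_2 \chi(G)\rceil + 1$.
   Context: $\chi(G)$ is the chromatic number of $G$. An elbow covering of $G$ is a set of orientations $\overrightarrow{G_1},\dots,\overrightarrow{G_k}$ of $G$ such that for every path $u,v,w$ of $G$ (i.e. $uv,vw\in E(G)$, $u\ne w$) there is an $i$ such that $u,v,w$ is not a directed path in $\overrightarrow{G_i}$. The elbow number $\mathit{elb}(G)$ is the minimum size of an elbow covering of $G$. *)

(* Defs.v *)
From HB Require Import structures.
From mathcomp Require Import all_boot all_order all_algebra.
From mathcomp Require Import reals exp.

Set Implicit Arguments.
Unset Strict Implicit.
Unset Printing Implicit Defensive.

Record sgraph := SGraph {
  vertex : finType;
  adj : rel vertex;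
  adj_sym : symmetric adj;
  adj_irrefl : irreflexive adj
}.

Section Coloring.
Variable G : sgraph.

Definition proper_coloring (k : nat) (c : {ffun vertex G -> 'I_k}) : bool :=
  [forall u, forall v, adj u v ==> (c u != c v)].

Definition colorable : pred nat :=
  fun k => [exists c : {ffun vertex G -> 'I_k}, proper_coloring c].

Lemma colorable_ex : exists k, colorable k.
Proof.
exists #|vertex G|; apply/existsP; exists [ffun x => enum_rank x].
apply/forallP=> u; apply/forallP=> v; apply/implyP=> uv.
rewrite !ffunE (inj_eq enum_rank_inj).
by apply: contraTneq uv => ->; rewrite adj_irrefl.
Qed.

Definition chromatic_number : nat := ex_minn colorable_ex.

End Coloring.

Section Elbow.
Variable G : sgraph.
Local Notation V := (vertex G).

(* An orientation is given by its set of arcs, (u, v) being the arc u -> v. *)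
Definition orientation (D : {set V * V}) : bool :=
  [forall u, forall v,
     if adj u v then ((u, v) \in D) (+) ((v, u) \in D) else (u, v) \notin D].

(* The path u, v, w and its reversal w, v, u are the same path of G, so being
   directed means being traversed by the arcs in either of the two directions. *)
Definition directed_path (D : {set V * V}) (u v w : V) : bool :=
  ((u, v) \in D) && ((v, w) \in D) || ((w, v) \in D) && ((v, u) \in D).

Definition elbow_covering (C : {set {set V * V}}) : bool :=
  [forall D in C, orientation D] &&
  [forall u, forall v, forall w, [&& adj u v, adj v w & u != w] ==>
     [exists D in C, ~~ directed_path D u v w]].

Definition elbow_coverable : pred nat :=
  fun k => [exists C : {set {set V * V}}, elbow_covering C && (#|C| == k)].

Lemma elbow_coverable_ex : exists k, elbow_coverable k.
Proof.
pose C := [set D | orientation D].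
exists #|C|; apply/existsP; exists C; rewrite eqxx andbT.
apply/andP; split; first by apply/forall_inP=> D; rewrite inE.
apply/forallP=> u; apply/forallP=> v; apply/forallP=> w.
apply/implyP=> /and3P[uv vw _].
pose r (x : V) : nat := if x == v then #|V| else enum_rank x.
have r_inj : injective r.
  move=> x y; rewrite /r; case: eqP => [->|_]; case: eqP => [->|_] //.
  - by move=> e; move: (ltn_ord (enum_rank y)); rewrite -e ltnn.
  - by move=> e; move: (ltn_ord (enum_rank x)); rewrite e ltnn.
  - by move=> e; apply/enum_rank_inj/val_inj.
pose D := [set p : V * V | adj p.1 p.2 && (r p.1 < r p.2)].
apply/existsP; exists D; apply/andP; split.
  rewrite inE; apply/forallP=> x; apply/forallP=> y.
  rewrite !inE /= (adj_sym y x); case xy: (adj x y) => //=.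
  case: ltngtP => // /r_inj exy.
  by rewrite exy adj_irrefl in xy.
have nv x : (v, x) \notin D.
  rewrite inE /= /r eqxx negb_and -leqNgt.
  by case: eqP => _; rewrite ?leqnn ?(ltnW (ltn_ord _)) orbT.
by rewrite /directed_path !(negbTE (nv _)) !andbF.
Qed.

Definition elbow_number : nat := ex_minn elbow_coverable_ex.

End Elbow.

Definition log2 (R : realType) (x : R) : R := (ln x / ln 2)%R.

(* Main.v *)
Require Import Defs.
From mathcomp Require Import all_boot all_order all_algebra.
From mathcomp Require Import reals exp.

(** Given an elbow covering [C], send an edge [uv] to the set [t(u,v)] of those
    orientations in [C] that contain the arc [u -> v].  Then [t(v,u)] is the complement of
    [t(u,v)], and [C] being an elbow covering says that [t(u,v) <> t(v,w)] along every
    path.  Hence the set of all [t(v,w)], for [w] adjacent to [v], contains at most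
    one member of each complementary pair, and adjacent vertices disagree on some
    pair.  There are [2 ^ (k - 1)] pairs, hence [2 ^ (2 ^ (k - 1))] colors suffice.
    Conversely, color [G] by functions from the pairs to [bool]; a chosen pair on
    which the colors of [u] and [v] differ, together with the value of the color of
    [u] there, defines [t(u,v)]. *)

Set Implicit Arguments.
Unset Strict Implicit.
Unset Printing Implicit Defensive.

Import Order.TTheory GRing.Theory Num.Theory.

Section Colorings.
Variable G : sgraph.
Local Notation V := (vertex G).

Lemma colorable_in (T : finType) (A : {set T}) (f : V -> T) :
  (forall v, f v \in A) -> (forall u v, adj u v -> f u != f v) ->
  colorable G #|A|.
Proof.
move=> fA f_proper; apply/existsP.
exists [ffun v => enum_rank_in (fA v) (f v)].
apply/forallP=> u; apply/forallP=> v; apply/implyP=> /f_proper.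
by apply: contraNneq; rewrite !ffunE => /enum_rank_in_inj->.
Qed.

Lemma colorable_map (T : finType) n :
  colorable G n -> n <= #|T| ->
  exists f : V -> T, forall u v, adj u v -> f u != f v.
Proof.
move=> /existsP[c c_proper] le_n.
exists (fun v => enum_val (widen_ord le_n (c v))) => u v uv.
have /forallP/(_ u)/forallP/(_ v)/implyP/(_ uv) := c_proper.
by rewrite (inj_eq enum_val_inj) -!val_eqE.
Qed.

Lemma chromatic_number_le n : colorable G n -> chromatic_number G <= n.
Proof. by rewrite /chromatic_number; case: ex_minnP => m _; apply. Qed.

Lemma chromatic_number_colorable : colorable G (chromatic_number G).
Proof. by rewrite /chromatic_number; case: ex_minnP. Qed.

End Colorings.

Section ElbowCoverings.
Variable G : sgraph.
Local Notation V := (vertex G).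

Lemma orientationP (D : {set V * V}) :
  reflect [/\ forall u v, (u, v) \in D -> adj u v
            & forall u v, adj u v -> ((v, u) \in D) = ((u, v) \notin D)]
          (orientation D).
Proof.
apply: (iffP idP) => [D_or|[DA DN]].
  have D_uv u v := forallP (forallP D_or u) v.
  split=> u v; have := D_uv u v; case: ifP => // uv; first by move/negbTE->.
  by move/addbP=> ->.
apply/forallP=> u; apply/forallP=> v; case: ifP => [uv|/negbT]; last exact/contra/DA.
by rewrite (DN _ _ uv) addbN addbb.
Qed.

Lemma orientation_exists : exists D : {set V * V}, orientation D.
Proof.
exists [set p | adj p.1 p.2 && (enum_rank p.1 < enum_rank p.2)].
apply/orientationP; split=> u v; first by rewrite inE => /andP[].
rewrite !inE /= (adj_sym v u) => uv; rewrite uv /=.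
case: ltngtP => // /ord_inj/enum_rank_inj euv.
by rewrite euv adj_irrefl in uv.
Qed.

Lemma elbow_coveringP (C : {set {set V * V}}) :
  reflect ((forall D, D \in C -> orientation D) /\
           forall u v w, adj u v -> adj v w -> u != w ->
             exists2 D, D \in C & ((u, v) \in D) != ((v, w) \in D))
          (elbow_covering C).
Proof.
(* An orientation holds exactly one of two opposite arcs, so the reversed traversal in
   [directed_path] says that both forward arcs are absent. *)
have directedE (D : {set V * V}) u v w : orientation D -> adj u v -> adj v w ->
    directed_path D u v w = (((u, v) \in D) == ((v, w) \in D)).
  move=> /orientationP[_ DN] uv vw; rewrite /directed_path (DN _ _ uv) (DN _ _ vw).
  by case: (_ \in D); case: (_ \in D).
apply: (iffP andP) => [[/forall_inP CO Cpath]|[CO Cpath]]; split=> //.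
- move=> u v w uv vw uw.
  have := implyP (forallP (forallP (forallP Cpath u) v) w).
  rewrite uv vw uw => /(_ isT)/exists_inP[D DC].
  by rewrite directedE ?CO //; exists D.
- exact/forall_inP.
- apply/forallP=> u; apply/forallP=> v; apply/forallP=> w.
  apply/implyP=> /and3P[uv vw uw]; have [D DC Duvw] := Cpath _ _ _ uv vw uw.
  by apply/exists_inP; exists D => //; rewrite directedE ?CO.
Qed.

(* [D0] picks from each complementary pair of subsets of [C] the member that
   contains [D0]. *)
Lemma elbow_covering_colorable_setD1 (C : {set {set V * V}}) (D0 : {set V * V}) :
  orientation D0 -> elbow_covering C -> colorable G (2 ^ (2 ^ #|C :\ D0|)).
Proof.
move=> /orientationP[D0A D0N] /elbow_coveringP[_ Cpath].
pose t u v := [set D in C :\ D0 | (u, v) \in D].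
(* Keeping only the arcs of [D0] that leave [v] selects the sets [t v w] whose pair representative
   contains [D0]; [D0] itself is then dropped. *)
pose f v := [set t v w | w in [set w | (v, w) \in D0]].
rewrite -card_powerset -card_powerset; apply: (colorable_in (f := f)) => [v|].
  rewrite powersetE; apply/subsetP=> _ /imsetP[w _ ->].
  by rewrite powersetE; apply/subsetP=> D; rewrite inE => /andP[].
suff f_neq u v : (u, v) \in D0 -> f u != f v.
  move=> u v uv; have [/f_neq //|] := boolP ((u, v) \in D0).
  by rewrite -(D0N _ _ uv) eq_sym => /f_neq.
(* [t u v] lies in [f u] but not in [f v]: otherwise it equals some [t v w], and the orientation
   separating the path [u, v, w] can be neither [D0] nor another member of [C]. *)
move=> uv; have : t u v \in f u by apply/imsetP; exists v; rewrite ?inE.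
apply: contraTneq => ->; apply/imsetP=> -[w]; rewrite inE => vw tuvw.
have uw : u != w.
  by apply: contraTneq vw => <-; rewrite (D0N _ _ (D0A _ _ uv)) uv.
have [D DC] := Cpath _ _ _ (D0A _ _ uv) (D0A _ _ vw) uw.
have [->|DD0] := eqVneq D D0; first by rewrite uv vw.
by have /setP/(_ D) := tuvw; rewrite !inE DD0 DC /= => ->; rewrite eqxx.
Qed.

Lemma elbow_covering_colorable (C : {set {set V * V}}) :
  elbow_covering C -> colorable G (2 ^ (2 ^ #|C|.-1)).
Proof.
(* For empty [C] any orientation serves as [D0], and the truncated predecessor gives the right
   exponent [0]. *)
move=> CC; have [C0|[D0 D0C]] := set_0Vmem C.
  have [D0 D0_or] := orientation_exists.
  by have := elbow_covering_colorable_setD1 D0_or CC; rewrite C0 set0D cards0.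
have /elbow_coveringP[CO _] := CC.
by have := elbow_covering_colorable_setD1 (CO _ D0C) CC; rewrite (cardsD1 D0 C) D0C.
Qed.

Lemma colorable_elbow_covering n m :
  colorable G n -> n <= 2 ^ (2 ^ m) ->
  exists2 C : {set {set V * V}}, elbow_covering C & #|C| <= m.+1.
Proof.
pose Y := {ffun 'I_m -> bool} => col_n le_n.
have [|c c_proper] := colorable_map (T := {ffun Y -> bool}) col_n.
  by rewrite !card_ffun card_bool card_ord.
pose y u v : Y := odflt [ffun=> false] [pick z | c u z != c v z].
(* Both orders of an edge pick the same [z], because the predicate is symmetric in [u] and [v]. *)
have yC u v : y u v = y v u.
  by rewrite /y; congr odflt; apply: eq_pick => z; rewrite eq_sym.
have yP u v : adj u v -> c v (y u v) = ~~ c u (y u v).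
  move=> /c_proper cuv; rewrite /y; case: pickP => [z|c_eq] /=.
    by case: (c u z); case: (c v z).
  by case/eqP: cuv; apply/ffunP=> z; apply/eqP/negbFE/c_eq.
(* The bit at [Some j] is [y u v j], complemented when the bit at [None] is set,
   so that swapping [u] and [v] complements all bits. *)
pose b (i : option 'I_m) u v :=
  c u (y u v) (+) (if i is Some j then y u v j else false).
pose D i := [set p : V * V | adj p.1 p.2 && b i p.1 p.2].
(* Different indices may yield the same orientation, hence only an upper bound on the size. *)
exists [set D i | i : option 'I_m]; last first.
  by rewrite (leq_trans (leq_imset_card _ _)) // card_option card_ord.
apply/elbow_coveringP; split=> [_ /imsetP[i _ ->]|u v w uv vw uw].
  apply/orientationP; split=> u v; first by rewrite inE => /andP[].
  move=> uv; rewrite !inE /= (adj_sym v u) uv /= /b (yC v u) (yP _ _ uv).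
  by rewrite addNb.
have [/existsP[i bi]|/existsPn b_eq] := boolP [exists i, b i u v != b i v w].
  by exists (D i); rewrite ?imset_f // !inE /= uv vw.
(* If no [D i] separates the path, bit [None] equates the color values, the other bits then equate
   [y u v] and [y v w], and [c u] and [c v] agree where [yP] makes them differ. *)
have b_uvw i : b i u v = b i v w by apply/eqP/negPn/b_eq.
have cuv : c u (y u v) = c v (y v w) by have := b_uvw None; rewrite /b !addbF.
have y_eq : y u v = y v w.
  by apply/ffunP=> j; have := b_uvw (Some j); rewrite /b cuv => /addbI.
by have := yP _ _ uv; rewrite cuv y_eq; case: (c v _).
Qed.

Lemma elbow_number_le (C : {set {set V * V}}) :
  elbow_covering C -> elbow_number G <= #|C|.
Proof.
move=> CC; rewrite /elbow_number; case: ex_minnP => k _; apply.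
by apply/existsP; exists C; rewrite CC eqxx.
Qed.

Lemma elbow_number_covering :
  exists2 C : {set {set V * V}}, elbow_covering C & #|C| = elbow_number G.
Proof.
rewrite /elbow_number; case: ex_minnP => k /existsP[C /andP[CC /eqP <-]] _.
by exists C.
Qed.

Lemma chromatic_number_le_elbow :
  chromatic_number G <= 2 ^ (2 ^ (elbow_number G).-1).
Proof.
have [C CC <-] := elbow_number_covering.
exact/chromatic_number_le/elbow_covering_colorable.
Qed.

Lemma elbow_number_leS m :
  chromatic_number G <= 2 ^ (2 ^ m) -> elbow_number G <= m.+1.
Proof.
move=> /(colorable_elbow_covering (chromatic_number_colorable G))[C CC].
exact/leq_trans/elbow_number_le.
Qed.

End ElbowCoverings.

Section Log2.
Variable R : realType.
Local Open Scope ring_scope.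

Lemma ln2_gt0 : 0 < ln 2 :> R.
Proof. by rewrite ln_gt0 // ltr1n. Qed.

Lemma log2X n : log2 (2 ^+ n : R) = n%:R.
Proof.
by rewrite /log2 lnXn ?ltr0n // -[ln 2 *+ n]mulr_natl mulfK // gt_eqF ?ln2_gt0.
Qed.

Lemma ler_log2 : {in Num.pos &, {mono @log2 R : x y / x <= y}}.
Proof. by move=> x y x0 y0; rewrite /log2 ler_pM2r ?ler_ln // invr_gt0 ln2_gt0. Qed.

Lemma ltr_log2 : {in Num.pos &, {mono @log2 R : x y / x < y}}.
Proof. by move=> x y x0 y0; rewrite /log2 ltr_pM2r ?ltr_ln // invr_gt0 ln2_gt0. Qed.

Lemma log2_gt0 (x : R) : 1 < x -> 0 < log2 x.
Proof. by move=> x1; rewrite /log2 divr_gt0 ?ln2_gt0 ?ln_gt0. Qed.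

Lemma ceil_log2_log2 (n m : nat) : (2 ^ (2 ^ m) < n <= 2 ^ (2 ^ m.+1))%N ->
  Num.ceil (log2 (log2 (n%:R : R))) = m.+1%:Z.
Proof.
move=> /andP[lt_n le_n].
have n1 : 1 < n%:R :> R by rewrite ltr1n (leq_ltn_trans _ lt_n) // expn_gt0.
have n0 : (n%:R : R) \is Num.pos by rewrite posrE (lt_trans ltr01).
have l0 : log2 (n%:R : R) \is Num.pos by rewrite posrE log2_gt0.
have e0 k : (2 ^+ k : R) \is Num.pos by rewrite posrE exprn_gt0 ?ltr0n.
have e2 k : log2 (2 ^ (2 ^ k))%:R = 2 ^+ k :> R by rewrite natrX log2X natrX.
have p0 k : ((2 ^ k)%:R : R) \is Num.pos by rewrite natrX.
apply: ceil_def; rewrite -addn1 PoszD addrK -PoszD addn1; apply/andP; split.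
  by rewrite -pmulrn -[m%:R]log2X ltr_log2 // -e2 ltr_log2 // ltr_nat.
by rewrite -pmulrn -[m.+1%:R]log2X ler_log2 // -e2 ler_log2 // ler_nat.
Qed.

End Log2.

Theorem theorem11 (R : realType) (G : sgraph) :
  3 <= chromatic_number G ->
  ((elbow_number G)%:Z =
     Num.ceil (log2 (log2 ((chromatic_number G)%:R : R))) + 1)%R.
Proof.
move=> chi3; have le_chi := chromatic_number_le_elbow G.
(* Elbow numbers 0 and 1 would both bound the chromatic number by [2 ^ (2 ^ 0) = 2]. *)
have elb2 : 1 < elbow_number G.
  by case: (elbow_number G) le_chi => [|[|k]] // /(leq_trans chi3).
case elbE: (elbow_number G) elb2 le_chi => [|[|m]] // _ le_chi.
rewrite (@ceil_log2_log2 R _ m) ?le_chi ?andbT; first by rewrite -PoszD addn1.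
(* With elbow number [m.+2], a chromatic number of at most [2 ^ (2 ^ m)] would allow a covering by
   [m.+1] orientations. *)
by rewrite ltnNge; apply/negP=> /elbow_number_leS; rewrite elbE ltnn.
Qed.
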